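(* Let $K\ge 1$, $\beta=(\beta_1,\dots,\beta_K)\in\mathbb{R}^K$ with $\beta_j\ge 0$ for all $j\ge 2$, let $m_*\in U_\beta$, and let $\eta>0$ be fixed as in the context. Let $\mathcal{M}_{\beta,m_*}$ denote the corresponding phase measure of the $N$-spin generalized Curie--Weiss model, and consider a random spin configuration $X\sim\mathcal{M}_{\beta,m_*}$. Then there is some constant $c>0$ (not depending on $N$) such that for any coordinate-wise increasing functions $f,g:\{0,1\}^N\to\mathbb{R}$, $$\operatorname{Cov}[f(X),g(X)]\ \ge\ -e^{-cN}\,\|f\|_\infty\,\|g\|_\infty .$$
   Context: Generalized Curie--Weiss model. Let $h(m)=\sum_{j=1}^K\beta_j m^j$, where $\beta_j\ge0$ for $j\ge2$ ($\beta_1$ may be negative). For $x\in\{0,1\}^N$ let $m(x)=\frac1N\sum_{i=1}^N x(i)$. The full measure is the probability measure $\nu_\beta$ on $\{0,1\}^N$ with $\nu_\beta(x)\propto\exp(N\,h(m(x)))$. Let $L(m)=h(m)-m\log m-(1-m)\log(1-m)$ for $m\in[0,1]$ (with $0\log 0=0$). Let $M_\beta\subseteq[0,1]$ be the set of global maximizers of $L$ on $[0,1]$, and $U_\beta=\{m_*\in M_\beta: L''(m_* )<0\}$. Phase measures: fix $\eta>0$ small enough that the sets $\{x\in\{0,1\}^N:|m(x)-m_*|\le\eta\}$, $m_*\in M_\beta$, are pairwise disjoint ($\eta$ does not depend on $N$). For $m_*\in M_\beta$, $\mathcal{M}_{\beta,m_*}$ is $\nu_\beta$ conditioned on $\{x:|m(x)-m_*|\le\eta\}$.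 $\|f\|_\infty$ is the maximum of $|f|$ over $\{0,1\}^N$. Coordinate-wise increasing means nondecreasing in each coordinate. The quantities $K,\beta,m_*,\eta$ are fixed as $N$ varies, and the constant $c$ may depend on them.
   Formalization: The bound is proved for all N ≥ N0, with N0 depending only on K, β, m_*, η; for every N it is false: with β=0, m_*=1/2, η<1/2, N=2, f=2x(1)-1, g=2x(2)-1 the covariance is -1 while both sup norms are 1. *)

(* Defs.v *)
From HB Require Import structures.
From mathcomp Require Import all_boot all_order all_algebra.
From mathcomp Require Import all_classical all_reals all_analysis.

Set Implicit Arguments.
Unset Strict Implicit.
Unset Printing Implicit Defensive.

Import Order.TTheory GRing.Theory Num.Theory.
Import numFieldNormedType.Exports.

Local Open Scope classical_set_scope.
Local Open Scope ring_scope.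

Definition config (N : nat) := {ffun 'I_N -> bool}.

(* Indices are shifted by one: [beta j] is the coefficient of m ^ (j + 1). *)
Definition hamiltonian (R : realType) (K : nat) (beta : 'I_K -> R) (m : R) : R :=
  \sum_(j < K) beta j * m ^+ j.+1.

Definition magnetization (R : realType) (N : nat) (x : config N) : R :=
  (\sum_(i < N) (x i)%:R) / N%:R.

Definition gibbs_weight (R : realType) (K : nat) (beta : 'I_K -> R) (N : nat)
    (x : config N) : R :=
  expR (N%:R * hamiltonian beta (magnetization R x)).

Definition full_measure (R : realType) (K : nat) (beta : 'I_K -> R) (N : nat)
    (x : config N) : R :=
  gibbs_weight beta x / \sum_(y : config N) gibbs_weight beta y.

(* Since ln 0 = 0 in the library, the convention 0 log 0 = 0 is built in. *)
Definition free_energy (R : realType) (K : nat) (beta : 'I_K -> R) (m : R) : R :=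
  hamiltonian beta m - m * ln m - (1 - m) * ln (1 - m).

Definition maximizers (R : realType) (K : nat) (beta : 'I_K -> R) : set R :=
  [set m | m \in `[0, 1] /\
           forall y : R, y \in `[0, 1] -> free_energy beta y <= free_energy beta m].

(* Elements of [maximizers beta] lie in the open interval ]0, 1[ (the entropy
   has infinite slope at 0 and 1), so the values of [free_energy] outside
   [0, 1] do not affect the second derivative below. *)
Definition nondeg_maximizers (R : realType) (K : nat) (beta : 'I_K -> R) : set R :=
  [set m | maximizers beta m /\ ((free_energy beta)^`(2%N))%classic m < 0].

Definition phase_region (R : realType) (N : nat) (eta m0 : R) : {set config N} :=
  [set x : config N | `|magnetization R x - m0| <= eta]%SET.

(* The phase regions around the maximizers are pairwise disjoint, with the same
   eta for every number N of spins. *)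
Definition separating_radius (R : realType) (K : nat) (beta : 'I_K -> R)
    (eta : R) : Prop :=
  forall N : nat, (0 < N)%N ->
    trivIset (maximizers beta) (fun m => [set` phase_region N eta m]).

Definition conditioned (R : realType) (T : finType) (nu : T -> R) (A : {set T})
    (x : T) : R :=
  if x \in A then nu x / \sum_(y in A) nu y else 0.

Definition phase_measure (R : realType) (K : nat) (beta : 'I_K -> R) (eta m0 : R)
    (N : nat) : config N -> R :=
  conditioned (@full_measure R K beta N) (phase_region N eta m0).

Definition mean (R : realType) (T : finType) (mu : T -> R) (f : T -> R) : R :=
  \sum_(x : T) mu x * f x.

Definition cov (R : realType) (T : finType) (mu : T -> R) (f g : T -> R) : R :=
  mean mu (fun x => (f x - mean mu f) * (g x - mean mu g)).

Definition sup_norm (R : realType) (T : finType) (f : T -> R) : R :=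
  \big[Num.max/0]_(x : T) `|f x|.

Definition coord_increasing (R : realType) (N : nat) (f : config N -> R) : Prop :=
  forall (i : 'I_N) (x y : config N),
    (forall j : 'I_N, j != i -> x j = y j) -> (x i <= y i)%N -> f x <= f y.

(* Main.v *)
(* Outside a small window around m_star, replace h by its tangent lines at the
   two ends of the window.  Since h is convex on [0, 1], the new potential is
   convex, so the measure it defines on the whole cube is positively correlated
   (FKG).  The ends of the window are chosen so that L increases at the left one
   and decreases at the right one; then the entropy beats the slopes of the
   tangents, and the new measure, like the phase measure, has exponentially small
   mass outside the window.  As the two weights coincide inside the window, the
   measures are exponentially close and the covariances differ by an exponentially
   small amount.  The large-deviation estimates all come from comparison with
   product Bernoulli measures; the total mass is bounded below by exp (N L(m_star))
   because the tangent line at m_star tilts to an exact Bernoulli measure. *)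
Require Import Defs.
From HB Require Import structures.
From mathcomp Require Import all_boot all_order all_algebra.
From mathcomp Require Import all_classical all_reals all_analysis.
From mathcomp Require Import ring lra.

Set Implicit Arguments.
Unset Strict Implicit.
Unset Printing Implicit Defensive.

Import Order.TTheory GRing.Theory Num.Theory.
Import numFieldNormedType.Exports.

Local Open Scope classical_set_scope.
Local Open Scope ring_scope.

(** * Configurations split into the first spin and the others *)

Definition ones (N : nat) (x : config N) : nat := \sum_(i < N) x i.

Definition ccons (N : nat) (b : bool) (y : config N) : config N.+1 :=
  [ffun i => if unlift ord0 i is Some j then y j else b].

Lemma ccons0 N b (y : config N) : ccons b y ord0 = b.
Proof. by rewrite ffunE unlift_none. Qed.

Lemma cconsS N b (y : config N) j : ccons b y (lift ord0 j) = y j.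
Proof. by rewrite ffunE liftK. Qed.

Lemma ones_ccons N b (y : config N) : ones (ccons b y) = (b + ones y)%N.
Proof.
rewrite /ones big_ord_recl ccons0; congr addn.
by apply: eq_bigr => j _; rewrite cconsS.
Qed.

Lemma sum_ccons (R : nmodType) N (F : config N.+1 -> R) :
  \sum_x F x = \sum_y F (ccons false y) + \sum_y F (ccons true y).
Proof.
rewrite (reindex (fun p : bool * config N => ccons p.1 p.2)) /=; last first.
  exists (fun x : config N.+1 => (x ord0, [ffun j => x (lift ord0 j)])).
    move=> [b y] _ /=; rewrite ccons0; congr pair.
    by apply/ffunP => j; rewrite ffunE cconsS.
  move=> x _ /=; apply/ffunP => i; rewrite ffunE.
  by case: unliftP => [j ->|->] //; rewrite ffunE.
rewrite -(pair_bigA _ (fun b y => F (ccons b y))) /=.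
by rewrite big_bool /= addrC.
Qed.

(** * Increasing functions and positive correlation under exchangeable weights *)

Lemma coord_increasing_ccons (R : realType) N b (f : config N.+1 -> R) :
  coord_increasing f -> coord_increasing (fun y => f (ccons b y)).
Proof.
move=> finc i x y xy xyi; apply: (finc (lift ord0 i)); last by rewrite !cconsS.
move=> j; case: (unliftP ord0 j) => [k ->|->]; last by rewrite !ccons0.
by rewrite (inj_eq lift_inj) !cconsS; exact: xy.
Qed.

Lemma le_ccons (R : realType) N (f : config N.+1 -> R) y :
  coord_increasing f -> f (ccons false y) <= f (ccons true y).
Proof.
move=> finc; apply: (finc ord0); last by rewrite !ccons0.
by move=> j; case: (unliftP ord0 j) => [k ->|->]; rewrite ?eqxx// !cconsS.
Qed.

Lemma coord_increasing_ones (R : realType) N (r : nat -> R) :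
  {homo r : m n / (m <= n)%N >-> m <= n} ->
  coord_increasing (fun x : config N => r (ones x)).
Proof.
move=> rinc i x y xy xyi; apply: rinc; rewrite /ones.
rewrite (bigD1 i) //= [leqRHS](bigD1 i) //= leq_add//.
by rewrite leq_sum// => j /xy ->.
Qed.

(** Law of total covariance for a mixture of two measures of masses [Z0] and [Z1], where [F], [G],
    [A] stand for the unnormalized means of [f], [g], [f * g]. Each component is positively
    correlated, and the term left over is the product of the increments of the two means, both
    nonnegative. *)
Lemma mix_correlations (R : realFieldType) (Z0 Z1 A0 A1 F0 F1 G0 G1 : R) :
  0 < Z0 -> 0 < Z1 -> F0 * Z1 <= Z0 * F1 -> G0 * Z1 <= Z0 * G1 ->
  F0 * G0 <= Z0 * A0 -> F1 * G1 <= Z1 * A1 ->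
  (F0 + F1) * (G0 + G1) <= (Z0 + Z1) * (A0 + A1).
Proof.
move=> Z0p Z1p dF dG A0p A1p.
have A0l : F0 * G0 / Z0 <= A0 by rewrite ler_pdivrMr// (mulrC A0).
have A1l : F1 * G1 / Z1 <= A1 by rewrite ler_pdivrMr// (mulrC A1).
have ZZ : 0 < Z0 + Z1 by exact: addr_gt0.
apply: (@le_trans _ _ ((Z0 + Z1) * (F0 * G0 / Z0 + F1 * G1 / Z1))); last first.
  by rewrite ler_pM2l// lerD.
rewrite -subr_ge0.
have -> : (Z0 + Z1) * (F0 * G0 / Z0 + F1 * G1 / Z1) - (F0 + F1) * (G0 + G1) =
  (Z0 * F1 - F0 * Z1) * (Z0 * G1 - G0 * Z1) / (Z0 * Z1).
  by field; rewrite !gt_eqF.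
by apply: divr_ge0; apply: mulr_ge0; rewrite ?subr_ge0 // ltW.
Qed.

(* Splitting off one coordinate gives two exchangeable measures on the other
   coordinates; the one with the coordinate up has increasing density
   w k.+1 / w k with respect to the other, hence dominates it. *)
Lemma fkg_exchangeable (R : realType) N (w : nat -> R) (f g : config N -> R) :
  (forall k, 0 < w k) -> (forall k, w k.+1 ^+ 2 <= w k * w k.+2) ->
  coord_increasing f -> coord_increasing g ->
  (\sum_x w (ones x) * f x) * (\sum_x w (ones x) * g x) <=
  (\sum_(x : config N) w (ones x)) * (\sum_x w (ones x) * (f x * g x)).
Proof.
elim: N w f g => [|N IH] w f g w0 wconv finc ginc.
  have E x : x = [ffun i : 'I_0 => false] by apply/ffunP; case.
  have S F : \sum_(x : config 0) F x = F [ffun i => false] :> R.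
    rewrite (bigD1 [ffun i => false]) //= big1 ?addr0// => x.
    by rewrite (E x) eqxx.
  by rewrite !S le_eqVlt; apply/orP; left; apply/eqP; ring.
pose w1 k := w k.+1.
have w10 k : 0 < w1 k by exact: w0.
have w1conv k : w1 k.+1 ^+ 2 <= w1 k * w1 k.+2 by exact: wconv.
rewrite !sum_ccons.
under [X in (X + _) * _ <= _]eq_bigr do rewrite ones_ccons add0n.
under [X in (_ + X) * _ <= _]eq_bigr do rewrite ones_ccons add1n -/(w1 _).
under [X in _ * (X + _) <= _]eq_bigr do rewrite ones_ccons add0n.
under [X in _ * (_ + X) <= _]eq_bigr do rewrite ones_ccons add1n -/(w1 _).
under [X in _ <= (X + _) * _]eq_bigr do rewrite ones_ccons add0n.
under [X in _ <= (_ + X) * _]eq_bigr do rewrite ones_ccons add1n -/(w1 _).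
under [X in _ <= _ * (X + _)]eq_bigr do rewrite ones_ccons add0n.
under [X in _ <= _ * (_ + X)]eq_bigr do rewrite ones_ccons add1n -/(w1 _).
have pos (v : nat -> R) : (forall k, 0 < v k) -> 0 < \sum_(x : config N) v (ones x).
  move=> v0; rewrite (bigD1 [ffun=> false])//= ltr_pwDl// sumr_ge0// => x _.
  exact: ltW.
have dom (u : config N.+1 -> R) : coord_increasing u ->
    (\sum_(y : config N) w (ones y) * u (ccons false y)) *
      (\sum_(y : config N) w1 (ones y)) <=
    (\sum_(y : config N) w (ones y)) *
      (\sum_(y : config N) w1 (ones y) * u (ccons true y)).
  move=> uinc.
  (* The induction hypothesis serves a second time, with this density ratio as second function: it
     turns means under [w] into means under [w1]. Log-convexity of [w] is what makes the ratio
     increasing. *)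
  have rinc : {homo (fun k => w1 k / w k) : m n / (m <= n)%N >-> m <= n}.
    apply: homo_leq => [x //|y x z|k]; first exact: le_trans.
    rewrite ler_pdivrMr// mulrAC ler_pdivlMr// -expr2.
    by rewrite mulrC; exact: wconv.
  have := IH w _ _ w0 wconv (coord_increasing_ccons false uinc)
    (coord_increasing_ones rinc).
  have E y : w (ones y) * (w1 (ones y) / w (ones y)) = w1 (@ones N y).
    by rewrite mulrCA divff ?mulr1// gt_eqF.
  under [X in _ * X <= _]eq_bigr do rewrite E.
  move/le_trans; apply; rewrite ler_pM2l ?pos//.
  apply: ler_sum => y _; rewrite mulrCA E mulrC ler_pM2l//.
  exact: le_ccons.
apply: mix_correlations; [exact: pos|exact: pos|exact: dom|exact: dom|..].
  by apply: IH => //; exact: coord_increasing_ccons.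
by apply: IH => //; exact: coord_increasing_ccons.
Qed.

(** * Stability of covariances under a small change of the weights *)

Lemma ler_sup_norm (R : realType) (T : finType) (f : T -> R) x :
  `|f x| <= sup_norm f.
Proof. by rewrite /sup_norm; apply: le_bigmax. Qed.

Lemma sup_norm_ge0 (R : realType) (T : finType) (f : T -> R) : 0 <= sup_norm f.
Proof. by rewrite /sup_norm; apply: bigmax_ge_id. Qed.

Lemma cov_normalized (R : realType) (T : finType) (w f g : T -> R) :
  let S u := \sum_x w x * u x in
  let Z := \sum_x w x in
  Z != 0 ->
  cov (fun x => w x / Z) f g =
    (Z * S (fun x => f x * g x) - S f * S g) / Z ^+ 2.
Proof.
move=> S Z Z0; rewrite /cov.
have meanE u : mean (fun x => w x / Z) u = S u / Z.
  by rewrite /mean mulr_suml; apply: eq_bigr => x _; rewrite mulrAC.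
rewrite !meanE {1}/S.
under eq_bigr => x _.
  have -> : w x * ((f x - S f / Z) * (g x - S g / Z)) =
    w x * (f x * g x) - (S g / Z) * (w x * f x) - (S f / Z) * (w x * g x)
      + (S f / Z) * (S g / Z) * w x by ring.
  over.
rewrite big_split /= !sumrB -!mulr_sumr -/(S f) -/(S g) -/Z.
by rewrite -/(S (fun x => f x * g x)); field.
Qed.

(** Telescoping the unnormalized covariance from [w] to [w'] gives four errors, with coefficients 1,
    2, 1, 2 in front of [e * Z] times the sup norms; hence the 6. The factors 2 arise because the
    mass of [w'] in absolute value is at most [Z + e <= 2 * Z]. *)
Lemma cov_perturbation (R : realType) (T : finType) (w w' f g : T -> R) (e : R) :
  let Z := \sum_x w x in
  (forall x, 0 <= w x) -> 0 < Z -> \sum_x `|w x - w' x| <= e -> e <= Z ->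
  (\sum_x w' x * f x) * (\sum_x w' x * g x) <=
    (\sum_x w' x) * (\sum_x w' x * (f x * g x)) ->
  - (6 * e / Z) * sup_norm f * sup_norm g <= cov (fun x => w x / Z) f g.
Proof.
move=> Z w0 Z0 we eZ corr.
rewrite cov_normalized ?gt_eqF// -/Z.
pose Z' := \sum_x w' x; rewrite -/Z' in corr.
pose S u := \sum_x w x * u x; pose S' u := \sum_x w' x * u x.
rewrite -/(S f) -/(S g) -/(S (fun x => f x * g x)).
rewrite -/(S' f) -/(S' g) -/(S' (fun x => f x * g x)) in corr.
have e0 : 0 <= e by apply: le_trans we; exact: sumr_ge0.
have wl (v u : T -> R) B : (forall x, `|u x| <= B) ->
    `|\sum_x v x * u x| <= (\sum_x `|v x|) * B.
  move=> uB; apply: le_trans (ler_norm_sum _ _ _) _; rewrite mulr_suml.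
  by apply: ler_sum => x _; rewrite normrM ler_wpM2l.
have Zn : \sum_x `|w x| = Z by apply: eq_bigr => x _; rewrite ger0_norm.
have Z'n : \sum_x `|w' x| <= 2 * Z.
  apply: (@le_trans _ _ (\sum_x (`|w x| + `|w x - w' x|))).
    by apply: ler_sum => x _; rewrite -[X in `|X| <= _](subKr (w x)) ler_normB.
  by rewrite big_split /= Zn; lra.
have dl u B : 0 <= B -> (forall x, `|u x| <= B) -> `|S u - S' u| <= e * B.
  move=> B0 uB; rewrite /S /S' -sumrB.
  under eq_bigr do rewrite -mulrBl.
  by apply: le_trans (wl _ _ _ uB) _; rewrite ler_wpM2r.
have Sl u B : 0 <= B -> (forall x, `|u x| <= B) -> `|S u| <= Z * B.
  by move=> B0 uB; apply: le_trans (wl _ _ _ uB) _; rewrite Zn.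
have S'l u B : 0 <= B -> (forall x, `|u x| <= B) -> `|S' u| <= 2 * Z * B.
  by move=> B0 uB; apply: le_trans (wl _ _ _ uB) _; rewrite ler_wpM2r.
have ZZ' : `|Z - Z'| <= e.
  rewrite /Z /Z' -sumrB; apply: le_trans we; exact: ler_norm_sum.
set F := sup_norm f; set G := sup_norm g.
have F0 : 0 <= F := sup_norm_ge0 f.
have G0 : 0 <= G := sup_norm_ge0 g.
have fF x : `|f x| <= F := ler_sup_norm f x.
have gG x : `|g x| <= G := ler_sup_norm g x.
have fgFG x : `|f x * g x| <= F * G by rewrite normrM ler_pM.
have FG0 : 0 <= F * G by exact: mulr_ge0.
have d1 := dl _ _ FG0 fgFG; have d2 := S'l _ _ FG0 fgFG.
have d3 := dl _ _ F0 fF; have d4 := Sl _ _ G0 gG.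
have d5 := S'l _ _ F0 fF; have d6 := dl _ _ G0 gG.
move: d1 d2 d3 d4 d5 d6 corr.
move: (S (fun x => _)) (S' (fun x => _)) => a a'.
move: (S f) (S g) (S' f) (S' g) => p q p' q' d1 d2 d3 d4 d5 d6 corr.
rewrite ler_pdivlMr ?exprn_gt0//.
have -> : - (6 * e / Z) * F * G * Z ^+ 2 = - (6 * e * Z * F * G).
  by field; rewrite gt_eqF.
have -> : Z * a - p * q = (Z' * a' - p' * q') + ((a - a') * Z + a' * (Z - Z')
  - (p - p') * q - p' * (q - q')) by ring.
have t1 : `|(a - a') * Z| <= e * (F * G) * Z.
  by rewrite normrM (gtr0_norm Z0) ler_wpM2r// ltW.
have t2 : `|a' * (Z - Z')| <= 2 * Z * (F * G) * e by rewrite normrM ler_pM.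
have t3 : `|(p - p') * q| <= (e * F) * (Z * G) by rewrite normrM ler_pM.
have t4 : `|p' * (q - q')| <= (2 * Z * F) * (e * G) by rewrite normrM ler_pM.
move: t1 t2 t3 t4; rewrite !ler_norml => /andP[t1 _] /andP[t2 _] /andP[_ t3] /andP[_ t4].
have -> : - (6 * e * Z * F * G) = 0 + (- (e * (F * G) * Z) + - (2 * Z * (F * G) * e)
   - (e * F) * (Z * G) - (2 * Z * F) * (e * G)) by ring.
by apply: lerD; [rewrite subr_ge0|rewrite !lerB// lerD].
Qed.

(** * Large deviations by comparison with Bernoulli measures *)

Lemma magnetizationE (R : realType) N (x : config N) :
  magnetization R x = (ones x)%:R / N%:R.
Proof. by rewrite /magnetization /ones natr_sum. Qed.

Lemma ones_le N (x : config N) : (ones x <= N)%N.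
Proof.
rewrite /ones -[leqRHS]card_ord -sum1_card leq_sum// => i _; exact: leq_b1.
Qed.

Lemma magnetization_itv (R : realType) N (x : config N) :
  (0 < N)%N -> 0 <= magnetization R x <= 1.
Proof.
move=> N0; rewrite magnetizationE divr_ge0//= ler_pdivrMr ?ltr0n// mul1r ler_nat.
exact: ones_le.
Qed.

Definition bernoulli_weight (R : realType) (N : nat) (p : R) (x : config N) : R :=
  \prod_(i < N) (if x i then p else 1 - p).

Lemma sum_bernoulli_weight (R : realType) N (p : R) :
  \sum_(x : config N) bernoulli_weight p x = 1.
Proof.
rewrite /bernoulli_weight -(bigA_distr_bigA (fun _ b => if b then p else 1 - p)) /=.
by rewrite big1// => i _; rewrite big_bool /=; ring.
Qed.

Lemma bernoulli_weight_ge0 (R : realType) N (p : R) (x : config N) :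
  0 <= p <= 1 -> 0 <= bernoulli_weight p x.
Proof.
by move=> /andP[p0 p1]; apply: prodr_ge0 => i _; case: ifP; rewrite ?subr_ge0.
Qed.

(** Only the factors that occur in the product are asked to be positive. This covers [p = 0] and
    [p = 1] when [p] is the magnetization of a constant configuration. *)
Lemma bernoulli_weightE (R : realType) N (p : R) (x : config N) :
  (0 < N)%N -> (forall i, if x i then 0 < p else p < 1) ->
  bernoulli_weight p x = expR (N%:R *
    (magnetization R x * ln p + (1 - magnetization R x) * ln (1 - p))).
Proof.
move=> N0 px; rewrite /bernoulli_weight.
have -> : N%:R * (magnetization R x * ln p + (1 - magnetization R x) * ln (1 - p)) =
    \sum_(i < N) (if x i then ln p else ln (1 - p)).
  have NN : N%:R != 0 :> R by rewrite pnatr_eq0 -lt0n.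
  rewrite (eq_bigr (fun i => (x i)%:R * (ln p - ln (1 - p)) + ln (1 - p))); last first.
    by move=> i _; case: (x i); rewrite /=; ring.
  rewrite big_split /= -mulr_suml sumr_const card_ord -mulr_natl.
  by rewrite /magnetization; field.
rewrite expR_sum; apply: eq_bigr => i _; have := px i.
by case: (x i) => hp; rewrite lnK// posrE ?subr_gt0.
Qed.

Lemma bernoulli_weight_magnetization (R : realType) N (x : config N) :
  (0 < N)%N ->
  let m := magnetization R x in
  bernoulli_weight m x = expR (N%:R * (m * ln m + (1 - m) * ln (1 - m))).
Proof.
move=> N0 m; apply: bernoulli_weightE => // i.
have NR : (0 : R) < N%:R by rewrite ltr0n.
case: ifPn => xi.
  rewrite /m magnetizationE divr_gt0// ltr0n /ones (bigD1 i)//= xi.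
  by rewrite add1n.
rewrite /m magnetizationE ltr_pdivrMr// mul1r ltr_nat /ones.
rewrite -[ltnRHS]card_ord -sum1_card (bigD1 i)//= [ltnRHS](bigD1 i)//=.
by rewrite (negbTE xi) add0n add1n ltnS leq_sum// => j _; exact: leq_b1.
Qed.

(* Chernoff's bound, by comparison with independent spins of mean [a]. *)
Lemma sum_exp_affine_le (R : realType) N (a u v : R) (B : pred (config N)) :
  (0 < N)%N -> 0 < a < 1 ->
  (forall x, B x ->
     (magnetization R x - a) * (v + ln (1 - a) - ln a) <= 0) ->
  \sum_(x | B x) expR (N%:R * (u + v * (magnetization R x - a))) <=
  expR (N%:R * (u - a * ln a - (1 - a) * ln (1 - a))).
Proof.
move=> N0 /andP[a0 a1] Bx; set E := expR (N%:R * (u - _ - _)).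
apply: (@le_trans _ _ (\sum_(x | B x) E * bernoulli_weight a x)); last first.
  rewrite -[leRHS]mulr1 -(sum_bernoulli_weight N a) -mulr_sumr ler_wpM2l ?expR_ge0//.
  rewrite [leRHS](bigID B) /= lerDl sumr_ge0// => x _.
  by rewrite bernoulli_weight_ge0// !ltW.
apply: ler_sum => x /Bx; set m := magnetization R x => mx.
rewrite bernoulli_weightE//; last by move=> i; case: ifP.
rewrite -expRD ler_expR -mulrDr ler_wpM2l// -/m.
(* Per spin, the logarithm of the ratio of the two weights is exactly the product assumed
   nonpositive on [B]. *)
rewrite -subr_ge0 -oppr_le0; apply: le_trans mx; rewrite le_eqVlt; apply/orP; left.
by apply/eqP; ring.
Qed.

(** With the logit of [p] as slope, the summand is a constant multiple of the Bernoulli weight of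
    mean [p]. For [v = h'(p)] the condition on [v] says that [L'(p) = 0]. *)
Lemma sum_exp_tangent (R : realType) N (p u v : R) :
  (0 < N)%N -> 0 < p < 1 -> v = ln p - ln (1 - p) ->
  \sum_(x : config N) expR (N%:R * (u + v * (magnetization R x - p))) =
  expR (N%:R * (u - p * ln p - (1 - p) * ln (1 - p))).
Proof.
move=> N0 /andP[p0 p1] vE; set E := expR (N%:R * (u - _ - _)).
rewrite -[RHS]mulr1 -[in RHS](sum_bernoulli_weight N p) mulr_sumr.
apply: eq_bigr => x _; rewrite bernoulli_weightE//; last by move=> i; case: ifP.
by rewrite /E -expRD -mulrDr vE; congr (expR (_ * _)); ring.
Qed.

(** Method of types: the Gibbs weight of [x] is exp (N L(m)) times its weight under the Bernoulli
    measure of its own magnetization m. As m is one of the [N.+1] values k/N, summing these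
    probability measures over all k gives the prefactor. *)
Lemma sum_gibbs_weight_le (R : realType) K (beta : 'I_K -> R) N
    (B : pred (config N)) (l : R) :
  (0 < N)%N -> (forall x, B x -> free_energy beta (magnetization R x) <= l) ->
  \sum_(x | B x) gibbs_weight beta x <= N.+1%:R * expR (N%:R * l).
Proof.
move=> N0 Bl; have NR : (0 : R) < N%:R by rewrite ltr0n.
have bw0 (k : 'I_N.+1) (x : config N) : 0 <= bernoulli_weight (k%:R / N%:R : R) x.
  apply: bernoulli_weight_ge0; rewrite divr_ge0//= ler_pdivrMr// mul1r ler_nat.
  by rewrite -ltnS.
apply: (@le_trans _ _ (\sum_(x | B x) expR (N%:R * l) *
    \sum_(k < N.+1) bernoulli_weight (k%:R / N%:R) x)); last first.
  rewrite -mulr_sumr mulrC ler_wpM2r ?expR_ge0//.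
  apply: (@le_trans _ _ (\sum_(x : config N) \sum_(k < N.+1) bernoulli_weight (k%:R / N%:R) x)).
    by rewrite [leRHS](bigID B)/= lerDl sumr_ge0// => x _; rewrite sumr_ge0.
  rewrite exchange_big /=; under eq_bigr do rewrite sum_bernoulli_weight.
  by rewrite sumr_const card_ord.
apply: ler_sum => x /Bl; set m := magnetization R x => lx.
have xN : (ones x < N.+1)%N by rewrite ltnS ones_le.
apply: (@le_trans _ _ (expR (N%:R * l) * bernoulli_weight m x)).
  rewrite bernoulli_weight_magnetization// -/m -expRD /gibbs_weight ler_expR.
  rewrite -mulrDr ler_wpM2l// -/m; move: lx; rewrite /free_energy; lra.
rewrite ler_wpM2l ?expR_ge0// (bigD1 (Ordinal xN))//= /m magnetizationE lerDl.
by apply: sumr_ge0.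
Qed.

(** * Convexity of the Hamiltonian, derivative of the free energy, and its maximizers *)

Definition hamiltonian' (R : realType) (K : nat) (beta : 'I_K -> R) (m : R) : R :=
  \sum_(j < K) beta j * (j.+1%:R * m ^+ j).

Definition free_energy' (R : realType) (K : nat) (beta : 'I_K -> R) (m : R) : R :=
  hamiltonian' beta m - ln m + ln (1 - m).

Lemma exprn_tangent (R : realType) n (x y : R) : 0 <= x -> 0 <= y ->
  x ^+ n.+1 + n.+1%:R * x ^+ n * (y - x) <= y ^+ n.+1.
Proof.
move=> x0 y0; elim: n => [|n IH]; first by rewrite expr0 !expr1; lra.
rewrite [leRHS]exprS; apply: le_trans (ler_wpM2l y0 IH).
rewrite -subr_ge0.
have -> : y * (x ^+ n.+1 + n.+1%:R * x ^+ n * (y - x)) -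
    (x ^+ n.+2 + n.+2%:R * x ^+ n.+1 * (y - x)) =
  n.+1%:R * x ^+ n * (y - x) ^+ 2 by rewrite !exprS -[n.+2]addn1 natrD; ring.
by apply: mulr_ge0; [apply: mulr_ge0; [|exact: exprn_ge0]|exact: sqr_ge0].
Qed.

Lemma hamiltonian_tangent (R : realType) K (beta : 'I_K -> R) (x y : R) :
  (forall j : 'I_K, (2 <= j.+1)%N -> 0 <= beta j) -> 0 <= x -> 0 <= y ->
  hamiltonian beta x + hamiltonian' beta x * (y - x) <= hamiltonian beta y.
Proof.
move=> hb x0 y0; rewrite /hamiltonian /hamiltonian' mulr_suml -big_split /=.
apply: ler_sum => -[[|j] jK] _ /=.
  (* The linear term equals its own tangent, whatever the sign of its coefficient. *)
  by rewrite expr0 !expr1 le_eqVlt; apply/orP; left; apply/eqP; ring.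
set b := beta _; have b0 : 0 <= b by exact: hb.
rewrite -!mulrA -mulrDr ler_wpM2l// mulrA; exact: exprn_tangent.
Qed.

Lemma hamiltonian'_homo (R : realType) K (beta : 'I_K -> R) (x y : R) :
  (forall j : 'I_K, (2 <= j.+1)%N -> 0 <= beta j) -> 0 <= x -> x <= y ->
  hamiltonian' beta x <= hamiltonian' beta y.
Proof.
move=> hb x0 xy; apply: ler_sum => -[[|j] jK] _ /=; first by rewrite !expr0.
rewrite ler_wpM2l ?hb// ler_wpM2l//; apply: lerXn2r => //; rewrite nnegrE//.
exact: le_trans xy.
Qed.

(** The delicate point is 0, where |y ln y| <= 2 sqrt |y|: write y = s^2 and use ln (1/s) < 1/s. For
    y < 0 the function vanishes, by the default value of [ln]. *)
Lemma continuous_xlnx (R : realType) : continuous (fun x : R => x * ln x).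
Proof.
move=> x; have [x0|x0|->] := ltgtP x 0.
- apply: (near_cst_continuous 0); near=> y; rewrite ln0 ?mulr0// ltW//.
  by near: y; exact: lt_nbhsl.
- by apply: cvgM; [exact: cvg_id|exact: continuous_ln].
rewrite /continuous_at mul0r; apply: norm_cvg0.
apply: (@squeeze_cvgr _ _ _ _ (cst 0) (fun y : R => 2 * Num.sqrt `|y|)).
- near=> y; rewrite normr_ge0 /=; have [y0|y0] := leP y 0.
    by rewrite ln0// mulr0 normr0 mulr_ge0 ?sqrtr_ge0.
  have y1 : y < 1 by near: y; exact: lt_nbhsl.
  set s := Num.sqrt `|y|.
  have s0 : 0 < s by rewrite sqrtr_gt0 normr_gt0 gt_eqF.
  have yE : y = s ^+ 2 by rewrite sqr_sqrtr// gtr0_norm.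
  rewrite normrM (gtr0_norm y0) ler0_norm ?ln_le0 ?(ltW y1)// yE.
  have s' : 0 < s^-1 by rewrite invr_gt0.
  have := ln_sublinear s'; rewrite lnV ?posrE// lnXn// => ls.
  have : s ^+ 2 * (- ln s) <= s ^+ 2 * s^-1 by rewrite ler_wpM2l ?sqr_ge0// ltW.
  rewrite [s ^+ 2 * s^-1]mulrAC divff ?gt_eqF// mul1r mulr2n; lra.
- exact: cvg_cst.
- have : continuous (fun y : R => 2 * Num.sqrt `|y|).
    move=> z; apply: cvgM; first exact: cvg_cst.
    apply: (@continuous_comp _ _ _ (fun y : R => `|y|) Num.sqrt).
      exact: norm_continuous.
    exact: sqrt_continuous.
  move=> /(_ 0); rewrite /continuous_at normr0 sqrtr0 mulr0; exact.
Unshelve. all: by end_near. Qed.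

Lemma is_derive_hamiltonian (R : realType) K (beta : 'I_K -> R) (x : R) :
  is_derive x 1 (hamiltonian beta) (hamiltonian' beta x).
Proof.
have -> : hamiltonian beta = \sum_(j < K) beta j *: ((id : R -> R) ^+ j.+1).
  apply/funext => y; rewrite fct_sumE; apply: eq_bigr => j _.
  by rewrite scalrfctE exprfctE.
apply: is_derive_eq; apply: eq_bigr => j _.
by rewrite /GRing.scale /=; ring.
Qed.

Lemma is_derive_free_energy (R : realType) K (beta : 'I_K -> R) (x : R) :
  0 < x < 1 -> is_derive x 1 (free_energy beta) (free_energy' beta x).
Proof.
move=> /andP[x0 x1].
have x1' : 0 < 1 - x by rewrite subr_gt0.
have d1 : is_derive x 1 (fun y : R => 1 - y) (-1).
  have -> : (fun y : R => 1 - y) = cst 1 \- id by [].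
  by apply: is_derive_eq; rewrite sub0r.
have d2 : is_derive x 1 (fun y : R => ln (1 - y)) ((1 - x)^-1 * -1).
  exact: (@is_derive1_comp _ (@ln R) (fun y => 1 - y) _ _ _ (is_derive1_ln x1') d1).
have d3 := is_derive1_ln x0.
have d4 := is_derive_hamiltonian beta x.
have -> : free_energy beta = hamiltonian beta \- (id \* @ln R)
    \- ((fun y => 1 - y) \* (fun y => ln (1 - y))) by [].
apply: is_derive_eq.
rewrite /free_energy' /GRing.scale /=; field.
by rewrite !gt_eqF.
Qed.

Lemma continuous_free_energy (R : realType) K (beta : 'I_K -> R) :
  continuous (free_energy beta).
Proof.
move=> x; apply: cvgB; first apply: cvgB.
- apply/differentiable_continuous/derivable1_diffP.
  exact: (@ex_derive _ _ _ _ _ _ _ (is_derive_hamiltonian beta x)).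
- exact: continuous_xlnx.
apply: (@continuous_comp _ _ _ (fun y : R => 1 - y) (fun y : R => y * ln y)).
  by apply: cvgB; [exact: cvg_cst|exact: cvg_id].
exact: continuous_xlnx.
Qed.

(** Moving inwards from an end point by [e] costs h at most a constant times [e], by the tangent at
    that end, while the entropy gains at least [- e * ln e]. *)
Lemma maximizers_interior (R : realType) K (beta : 'I_K -> R) (m : R) :
  (forall j : 'I_K, (2 <= j.+1)%N -> 0 <= beta j) ->
  maximizers beta m -> 0 < m < 1.
Proof.
move=> hb [] /=; rewrite in_itv/= => /andP[m0 m1] mmax.
(* The entropy at distance [e] from the boundary exceeds [- e ln e]. *)
have small (s : R) : exists2 e : R, 0 < e < 1 & s < - ln e.
  have se : - `|s| - 1 < 0 by have := normr_ge0 s; lra.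
  exists (expR (- `|s| - 1)); first by rewrite expR_gt0 expR_lt1.
  by rewrite expRK; have := ler_norm s; lra.
have ent (e : R) : 0 < e < 1 -> 0 <= - ((1 - e) * ln (1 - e)).
  move=> /andP[e0 e1]; rewrite -mulrN mulr_ge0 ?subr_ge0 ?(ltW e1)// oppr_ge0.
  by rewrite ln_le0// lerBlDr lerDl ltW.
apply/andP; split; rewrite lt_neqAle ?m0 ?m1 andbT; apply/eqP.
- move=> mE; have [e /[dup] e01 /andP[e0 e1] he] := small (- hamiltonian' beta 0).
  have := mmax e; rewrite in_itv/= (ltW e0) (ltW e1) => /(_ isT).
  have := hamiltonian_tangent hb (lexx 0) (ltW e0); rewrite subr0.
  have := ent _ e01; rewrite -mE /free_energy subr0 ln1 mul0r mulr0 !subr0.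
  have : 0 < e * (- ln e + hamiltonian' beta 0) by rewrite mulr_gt0//; lra.
  by lra.
move=> mE; have [e /[dup] e01 /andP[e0 e1] he] := small (hamiltonian' beta 1).
have e1' : 0 <= 1 - e by rewrite subr_ge0 ltW.
have := mmax (1 - e); rewrite in_itv/= e1' lerBlDr lerDl (ltW e0) => /(_ isT).
have := hamiltonian_tangent hb ler01 e1'.
have := ent _ e01; rewrite mE /free_energy subKr subrr ln1 mul0r mulr0 !subr0.
have : 0 < e * (- ln e - hamiltonian' beta 1) by rewrite mulr_gt0//; lra.
by lra.
Qed.

Lemma free_energy'_maximizer (R : realType) K (beta : 'I_K -> R) (m : R) :
  maximizers beta m -> 0 < m < 1 -> free_energy' beta m = 0.
Proof.
move=> [_ mmax] m01.
have [] : is_derive m 1 (free_energy beta) 0.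
  apply: (@derive1_at_max _ _ 0 1) => //.
  - move=> t; rewrite in_itv/= => t01.
    exact: (@ex_derive _ _ _ _ _ _ _ (is_derive_free_energy beta t01)).
  - by move=> t; rewrite in_itv/= => /andP[t0 t1]; apply: mmax; rewrite in_itv/= !ltW.
move=> _ <-; apply/esym.
exact: (@derive_val _ _ _ _ _ _ _ (is_derive_free_energy beta m01)).
Qed.

(** * From disjoint phase regions to isolated maximizers *)

Lemma exists_config (N k : nat) : (k <= N)%N -> exists x : config N, ones x = k.
Proof.
elim: N k => [|N IH] [|k] kN //.
- by exists [ffun=> false]; rewrite /ones big_ord0.
- by have [x xE] := IH 0%N isT; exists (ccons false x); rewrite ones_ccons xE.
- by have [x xE] := IH k kN; exists (ccons true x); rewrite ones_ccons xE.
Qed.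

Lemma exists_magnetization (R : realType) (a b : R) : 0 <= a -> a < b -> b <= 1 ->
  exists N (x : config N), (0 < N)%N /\ a <= magnetization R x <= b.
Proof.
move=> a0 ab b1; have ba0 : 0 < b - a by rewrite subr_gt0.
(* As N (b - a) > 1, the largest multiple of 1/N not exceeding [b] is at least [a]. *)
pose N := (Num.truncn (b - a)^-1).+1.
have NR : (0 : R) < N%:R by rewrite ltr0n.
have Nab : (b - a)^-1 < N%:R by rewrite truncnS_gt.
have bN : 0 <= b * N%:R by rewrite mulr_ge0// (le_trans a0)// ltW.
have /andP[k1 k2] := truncn_itv bN.
have kN : (Num.truncn (b * N%:R) <= N)%N.
  rewrite -(ler_nat R); apply: le_trans k1 _.
  by rewrite ler_piMl// ltW.
have [x xE] := exists_config kN; exists N, x; split=> //.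
rewrite magnetizationE xE ler_pdivlMr// ler_pdivrMr// k1 andbT.
have : 1 <= (b - a) * N%:R by rewrite mulrC -ler_pdivrMr// mul1r ltW.
move: k2; rewrite -[X in _ < X -> _]natr1; lra.
Qed.

(** Between two distinct maximizers at distance at most [eta] lies the magnetization of some
    configuration, for a suitable number of spins; it would belong to both phase regions. *)
Lemma separated_maximizers (R : realType) K (beta : 'I_K -> R) (eta m m' : R) :
  separating_radius beta eta ->
  maximizers beta m -> maximizers beta m' -> `|m' - m| <= eta -> m = m'.
Proof.
move=> hsep; wlog mm' : m m' / m < m'.
  move=> H Mm Mm' d; have [lt|lt|//] := ltgtP m m'; first exact: H.
  by apply/esym/H; rewrite // distrC.
move=> Mm Mm'; have [] := (Mm, Mm') => -[] /=; rewrite in_itv/= => /andP[m0 _] _.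
move=> -[] /=; rewrite in_itv/= => /andP[_ m1] _.
rewrite gtr0_norm ?subr_gt0// => d.
have [N [x [N0 /andP[x1 x2]]]] := exists_magnetization m0 mm' m1.
apply: (hsep N N0) => //; exists x; split; rewrite /= inE ler_norml; lra.
Qed.

(** * The Hamiltonian extended by tangents outside a window *)

(** For [b <= a], the projection onto [b, a]; the lower end comes first. *)
Definition clamp (R : realType) (b a m : R) : R := Num.max b (Num.min a m).

(** The tangent to h at the projection of [m], evaluated at [m]: one formula for h inside the window
    and for both tangent lines outside. *)
Definition clamped_hamiltonian (R : realType) K (beta : 'I_K -> R) (b a m : R) : R :=
  hamiltonian beta (clamp b a m) +
  hamiltonian' beta (clamp b a m) * (m - clamp b a m).

Lemma clamp_itv (R : realType) (b a m : R) : b <= a -> b <= clamp b a m <= a.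
Proof. by move=> ba; rewrite /clamp le_max lexx/= ge_max ba ge_min lexx. Qed.

Lemma clamp_id (R : realType) (b a m : R) : b <= m <= a -> clamp b a m = m.
Proof. by move=> /andP[bm ma]; rewrite /clamp (min_idPr ma) (max_idPr bm). Qed.

Lemma clamp_ge (R : realType) (b a m : R) : b <= a -> a <= m -> clamp b a m = a.
Proof. by move=> ba am; rewrite /clamp (min_idPl am) (max_idPr ba). Qed.

Lemma clamp_le (R : realType) (b a m : R) : m <= b -> clamp b a m = b.
Proof. by move=> mb; rewrite /clamp; apply/max_idPl; rewrite ge_min mb orbT. Qed.

Lemma clamped_hamiltonian_id (R : realType) K (beta : 'I_K -> R) (b a m : R) :
  b <= m <= a -> clamped_hamiltonian beta b a m = hamiltonian beta m.
Proof. by move=> h; rewrite /clamped_hamiltonian clamp_id// subrr mulr0 addr0. Qed.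

(** Beyond an end of the window, h at that end lies above the tangent at [t], and the slopes are
    ordered because h' is nondecreasing. *)
Lemma clamped_hamiltonian_tangent (R : realType) K (beta : 'I_K -> R) (b a t y : R) :
  (forall j : 'I_K, (2 <= j.+1)%N -> 0 <= beta j) ->
  0 <= b -> b <= t <= a -> 0 <= y ->
  hamiltonian beta t + hamiltonian' beta t * (y - t) <= clamped_hamiltonian beta b a y.
Proof.
move=> hb b0 /andP[bt ta] y0.
have t0 : 0 <= t by exact: le_trans bt.
have ba : b <= a by exact: le_trans ta.
have a0 : 0 <= a by exact: le_trans ba.
have [ya|ay] := leP y a; last first.
  rewrite /clamped_hamiltonian clamp_ge ?(ltW ay)//.
  have := hamiltonian_tangent hb t0 a0.
  have : hamiltonian' beta t * (y - a) <= hamiltonian' beta a * (y - a).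
    by rewrite ler_wpM2r ?subr_ge0 ?(ltW ay)//; exact: hamiltonian'_homo.
  lra.
have [yb|yb] := leP y b; last first.
  by rewrite clamped_hamiltonian_id ?(ltW yb)//; exact: hamiltonian_tangent.
rewrite /clamped_hamiltonian clamp_le//.
have := hamiltonian_tangent hb t0 b0.
have : hamiltonian' beta b * (b - y) <= hamiltonian' beta t * (b - y).
  by rewrite ler_wpM2r ?subr_ge0//; exact: hamiltonian'_homo.
lra.
Qed.

(** Both values on the right lie above the tangent at [clamp b a y]. Its increments by [d] and [- d]
    cancel, and its value at [y] is the clamped Hamiltonian itself. *)
Lemma clamped_hamiltonian_midpoint (R : realType) K (beta : 'I_K -> R) (b a y d : R) :
  (forall j : 'I_K, (2 <= j.+1)%N -> 0 <= beta j) ->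
  0 <= b -> b <= a -> 0 <= y - d -> 0 <= y + d ->
  2 * clamped_hamiltonian beta b a y <=
  clamped_hamiltonian beta b a (y - d) + clamped_hamiltonian beta b a (y + d).
Proof.
move=> hb b0 ba yd0 yd1; have c := clamp_itv y ba.
have := clamped_hamiltonian_tangent hb b0 c yd0.
have := clamped_hamiltonian_tangent hb b0 c yd1.
rewrite [clamped_hamiltonian beta b a y]/clamped_hamiltonian.
move: (clamp _ _ _) (hamiltonian _ _) (hamiltonian' _ _) => z u s; lra.
Qed.

Lemma fkg_clamped (R : realType) K (beta : 'I_K -> R) (b a : R) N (f g : config N -> R) :
  let w x := expR (N%:R * clamped_hamiltonian beta b a (magnetization R x)) in
  (forall j : 'I_K, (2 <= j.+1)%N -> 0 <= beta j) ->
  0 <= b -> b <= a -> (0 < N)%N -> coord_increasing f -> coord_increasing g ->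
  (\sum_x w x * f x) * (\sum_x w x * g x) <=
  (\sum_x w x) * (\sum_x w x * (f x * g x)).
Proof.
move=> w hb b0 ba N0 finc ginc.
pose w' k := expR (N%:R * clamped_hamiltonian beta b a (k%:R / N%:R)).
have wE x : w x = w' (ones x) by rewrite /w magnetizationE.
rewrite (_ : w = w' \o @ones N); last exact/funext.
(* Log-convexity is required at every [k], also beyond [N]. The clamped potential is convex on the
   whole half-line, so its midpoint inequality with step 1/N applies. *)
apply: fkg_exchangeable => // k; first exact: expR_gt0.
have NR : (0 : R) < N%:R by rewrite ltr0n.
rewrite /w' -expRM_natl -expRD ler_expR mulrCA -mulrDr ler_wpM2l//.
have e1 : k%:R / N%:R = k.+1%:R / N%:R - N%:R^-1 :> R by rewrite -natr1; ring.
have e2 : k.+2%:R / N%:R = k.+1%:R / N%:R + N%:R^-1 :> R by rewrite -[k.+2]addn1 natrD; ring.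
rewrite e1 e2; apply: clamped_hamiltonian_midpoint => //.
by rewrite -e1 divr_ge0.
Qed.

(** * Choice of the window *)

(** Since L is strictly smaller on either side of [p], the mean value theorem yields a point [a] on
    the right where L' <= 0 and a point [b] on the left where L' >= 0. Compactness of the remaining
    outer intervals gives the gap [kappa]. *)
Lemma isolating_window (R : realType) K (beta : 'I_K -> R) (p eta : R) :
  0 < p < 1 -> 0 < eta ->
  (forall y, y \in `[0, 1] -> `|y - p| <= eta -> y != p ->
     free_energy beta y < free_energy beta p) ->
  exists b a kappa : R,
    [/\ [/\ 0 < b, b < p, p < a & a < 1], p - eta <= b, a <= p + eta,
        free_energy' beta a <= 0 <= free_energy' beta b &
        0 < kappa /\
        forall y, y \in `[0, 1] -> `|y - p| <= eta -> y <= b \/ a <= y ->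
          free_energy beta y <= free_energy beta p - kappa].
Proof.
move=> /andP[p0 p1] eta0 strict; set L := free_energy beta.
have Lcont (c d : R) : {within `[c, d], continuous L}.
  exact/continuous_subspaceT/continuous_free_energy.
have [a [pa a1 aeta La]] :
    exists a, [/\ p < a, a < 1, a <= p + eta & free_energy' beta a <= 0].
  (* The midpoint of [p] and 1 keeps [q], hence [a], below 1, where L is differentiable. *)
  pose q := Num.min (p + eta) ((1 + p) / 2).
  have pq : p < q by rewrite lt_min; apply/andP; split; lra.
  have qeta : q <= p + eta by rewrite ge_min lexx.
  have q1 : q < 1 by rewrite gt_min; apply/orP; right; lra.
  have [|a] := @MVT _ L (free_energy' beta) _ _ pq _ (Lcont p q).
    move=> x; rewrite in_itv/= => /andP[px xq]; apply: is_derive_free_energy.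
    by apply/andP; split; lra.
  rewrite in_itv/= => /andP[pa aq] E; exists a; split; try lra.
  have : L q - L p < 0.
    rewrite subr_lt0 strict ?gt_eqF// ?in_itv/= ?ler_norml; apply/andP; split; lra.
  by rewrite E pmulr_llt0 ?subr_gt0// => /ltW.
have [b [pb b0 beta' Lb]] :
    exists b, [/\ b < p, 0 < b, p - eta <= b & 0 <= free_energy' beta b].
  pose q := Num.max (p - eta) (p / 2).
  have qp : q < p by rewrite gt_max; apply/andP; split; lra.
  have qeta : p - eta <= q by rewrite le_max lexx.
  have q0 : 0 < q by rewrite lt_max; apply/orP; right; lra.
  have [|b] := @MVT _ L (free_energy' beta) _ _ qp _ (Lcont q p).
    move=> x; rewrite in_itv/= => /andP[qx xp]; apply: is_derive_free_energy.
    by apply/andP; split; lra.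
  rewrite in_itv/= => /andP[qb bp] E; exists b; split; try lra.
  have : 0 < L p - L q.
    rewrite subr_gt0 strict ?lt_eqF// ?in_itv/= ?ler_norml; apply/andP; split; lra.
  by rewrite E pmulr_lgt0 ?subr_gt0// => /ltW.
have am : a <= Num.min 1 (p + eta) by rewrite le_min (ltW a1).
have bm : Num.max 0 (p - eta) <= b by rewrite ge_max (ltW b0).
have [c1] := EVT_max am (Lcont _ _).
rewrite in_itv/= le_min => /and3P[ac1 c11 c1eta] c1max.
have [c2] := EVT_max bm (Lcont _ _).
rewrite in_itv/= ge_max => /andP[/andP[c20 c2eta] c2b] c2max.
have l1 : L c1 < L p.
  rewrite strict ?gt_eqF// ?in_itv/= ?ler_norml; try (apply/andP; split); lra.
have l2 : L c2 < L p.
  rewrite strict ?lt_eqF// ?in_itv/= ?ler_norml; try (apply/andP; split); lra.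
(* Here [c1] and [c2] maximize L over the right and left outer intervals. *)
exists b, a, (Num.min (L p - L c1) (L p - L c2)); split=> //; first by rewrite La Lb.
split; first by rewrite lt_min !subr_gt0 l1 l2.
move=> y; rewrite in_itv/= ler_norml => /andP[y0 y1] /andP[ye1 ye2] [yb|ay].
- have : L y <= L c2.
    by apply: c2max; rewrite in_itv/= ge_max yb y0/= andbT; lra.
  have : Num.min (L p - L c1) (L p - L c2) <= L p - L c2 by rewrite ge_min lexx orbT.
  rewrite -/L; lra.
have : L y <= L c1.
  by apply: c1max; rewrite in_itv/= le_min ay y1/=; lra.
have : Num.min (L p - L c1) (L p - L c2) <= L p - L c1 by rewrite ge_min lexx.
rewrite -/L; lra.
Qed.

(** * Assembly of the covariance bound *)

(** The normalization of the full measure cancels under conditioning, which leaves the form [w / Z]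
    treated by [cov_perturbation]. *)
Lemma phase_measureE (R : realType) K (beta : 'I_K -> R) (eta p : R) N :
  let w (x : config N) :=
    if x \in phase_region N eta p then gibbs_weight beta x else 0 in
  @phase_measure R K beta eta p N = fun x => w x / \sum_y w y.
Proof.
move=> w; apply/funext => x; rewrite /phase_measure /conditioned /full_measure /w.
have Z0 : 0 < \sum_(y : config N) gibbs_weight beta y.
  rewrite (bigD1 [ffun=> false])//= ltr_pwDl ?expR_gt0// sumr_ge0// => y _.
  exact: expR_ge0.
case: ifP => _; last by rewrite mul0r.
rewrite -mulr_suml -[in RHS]big_mkcond /= invfM invrK.
by rewrite mulrACA mulVf ?mulr1// gt_eqF.
Qed.

Lemma expR_dominates_linear (R : realType) (c : R) : 0 < c ->
  exists N0 : nat, forall N : nat, (N0 <= N)%N ->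
    8 * (N%:R + 3) <= expR (c * N%:R).
Proof.
move=> c0; exists (maxn 3 (Num.truncn (32 / c ^+ 2)).+1) => N.
rewrite geq_max -(ler_nat R) => /andP[N3 Nc].
have N1 : 32 / c ^+ 2 < N%:R.
  by apply: (lt_le_trans (truncnS_gt _)); rewrite ?ler_nat.
have cN : 0 <= c * N%:R by rewrite mulr_ge0// ltW.
apply: le_trans (expR_ge1Dxn 1 cN).
move: N1; rewrite ltr_pdivrMr ?exprn_gt0// => N1.
have : 32 * N%:R <= (N%:R * c ^+ 2) * N%:R by rewrite ler_wpM2r// ltW.
rewrite (_ : 2`! = 2)%N// exprMn; lra.
Qed.

(* The bound is asserted for all large N: it fails for N = 2, beta = 0,
   m_star = 1/2 and eta < 1/2, where the phase measure is uniform on two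
   incomparable configurations. *)
Theorem theorem1p1 (R : realType) (K : nat) (hK : (1 <= K)%N) (beta : 'I_K -> R)
    (hbeta : forall j : 'I_K, (2 <= j.+1)%N -> 0 <= beta j)
    (m_star : R) (hm : nondeg_maximizers beta m_star)
    (eta : R) (heta : 0 < eta) (hsep : separating_radius beta eta) :
  exists c : R, 0 < c /\
    exists N0 : nat, forall N : nat, (N0 <= N)%N ->
      forall f g : config N -> R,
        coord_increasing f -> coord_increasing g ->
        cov (@phase_measure R K beta eta m_star N) f g >=
          - expR (- (c * N%:R)) * sup_norm f * sup_norm g.
Proof.
have [Mm _] := hm; set p := m_star in Mm *; set L := free_energy beta p.
have p01 := maximizers_interior hbeta Mm; have /andP[p0 p1] := p01.
have Lp := free_energy'_maximizer Mm p01.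
have strict y : y \in `[0, 1] -> `|y - p| <= eta -> y != p -> free_energy beta y < L.
  move=> y01 yp ynp; have [_ pmax] := Mm; rewrite lt_neqAle pmax// andbT.
  apply: contra ynp => /eqP Ly; apply/eqP/esym.
  apply: (separated_maximizers hsep Mm) yp; split=> // z z01.
  by rewrite Ly; exact: pmax.
have [b [a [kappa [[b0 bp pa a1] peb ape /andP[La Lb] [k0 Lk]]]]] :=
  isolating_window p01 heta strict.
have a0 : 0 < a by exact: lt_trans pa.
have b1 : b < 1 by exact: lt_trans p1.
have ba : b <= a by rewrite ltW// (lt_trans bp).
have c0 : 0 < kappa / 2 by rewrite divr_gt0.
(* The error has rate [kappa]; half of it is spent on the factor N + 3 and the constants. *)
exists (kappa / 2); split=> //.
have [N0 N0P] := expR_dominates_linear c0; exists N0.+1 => N NN f g finc ginc.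
have N_gt0 : (0 < N)%N by exact: leq_trans NN.
have := N0P N (ltnW NN) => growth.
pose w (x : config N) := if x \in phase_region N eta p then gibbs_weight beta x else 0.
pose w' (x : config N) :=
  expR (N%:R * clamped_hamiltonian beta b a (magnetization R x)).
pose E := expR (N%:R * (L - kappa)).
have w0 x : 0 <= w x by rewrite /w; case: ifP => // _; exact: expR_ge0.
have w'0 x : 0 <= w' x by exact: expR_ge0.
have m01 (x : config N) := magnetization_itv R x N_gt0.
have tail_eq u : 0 < u < 1 -> free_energy beta u <= L - kappa ->
    expR (N%:R * (hamiltonian beta u - u * ln u - (1 - u) * ln (1 - u))) <= E.
  by move=> u01 uL; rewrite ler_expR ler_wpM2l.
(* L'(a) <= 0 means that h'(a) is at most the logit of [a], the sign needed for the Chernoff bound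
   to the right of [a]. The left tail is symmetric. *)
have tail_a : \sum_(x | a <= magnetization R x) w' x <= E.
  have a01 : 0 < a < 1 by rewrite a0.
  apply: le_trans (tail_eq a a01 _); last first.
    apply: Lk; [rewrite in_itv/= !ltW//|rewrite ler_norml; lra|by right].
  apply: le_trans (sum_exp_affine_le (B := fun x => a <= magnetization R x) (v := hamiltonian' beta a)
    (hamiltonian beta a) N_gt0 a01 _); last first.
    move=> x ax; rewrite mulr_ge0_le0 ?subr_ge0//.
    by move: La; rewrite /free_energy'; lra.
  by apply: ler_sum => x ax; rewrite /w' /clamped_hamiltonian clamp_ge.
have tail_b : \sum_(x | magnetization R x <= b) w' x <= E.
  have b01 : 0 < b < 1 by rewrite b0.
  apply: le_trans (tail_eq b b01 _); last first.
    apply: Lk; [rewrite in_itv/= !ltW//|rewrite ler_norml; lra|by left].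
  apply: le_trans (sum_exp_affine_le (B := fun x => magnetization R x <= b) (v := hamiltonian' beta b)
    (hamiltonian beta b) N_gt0 b01 _); last first.
    move=> x xb; rewrite mulr_le0_ge0 ?subr_le0//.
    by move: Lb; rewrite /free_energy'; lra.
  by apply: ler_sum => x xb; rewrite /w' /clamped_hamiltonian clamp_le.
(* The part of the phase region outside the open window, where only [w] remains to be controlled. *)
pose B (x : config N) := (x \in phase_region N eta p) &&
  ((magnetization R x <= b) || (a <= magnetization R x)).
have shell : \sum_(x | B x) gibbs_weight beta x <= N.+1%:R * E.
  apply: sum_gibbs_weight_le => // x /andP[]; rewrite inE => xp /orP xba.
  by apply: Lk => //; rewrite in_itv/= m01.
have total : expR (N%:R * L) <= \sum_x w' x.
  have -> : L = hamiltonian beta p - p * ln p - (1 - p) * ln (1 - p) by [].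
  have v : hamiltonian' beta p = ln p - ln (1 - p).
    by move: Lp; rewrite /free_energy'; lra.
  rewrite -(sum_exp_tangent _ N_gt0 p01 v); apply: ler_sum => x _.
  rewrite ler_expR ler_wpM2l//; apply: clamped_hamiltonian_tangent => //.
  - exact: ltW.
  - by rewrite !ltW.
  - by have /andP[] := m01 x.
(* N + 1 for the shell [B] under [w], and 1 for each tail under [w']. *)
pose e := (N%:R + 3) * E.
have dist : \sum_x `|w x - w' x| <= e.
  apply: (@le_trans _ _ (\sum_(x | B x) gibbs_weight beta x +
      \sum_(x | a <= magnetization R x) w' x +
      \sum_(x | magnetization R x <= b) w' x)); last first.
    rewrite /e (_ : (N%:R + 3) * E = N.+1%:R * E + E + E) ?lerD//.
    by rewrite -natr1; ring.
  rewrite [X in _ <= X + _ + _]big_mkcond [X in _ <= _ + X + _]big_mkcond.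
  rewrite [X in _ <= _ + _ + X]big_mkcond.
  rewrite -!big_split /=; apply: ler_sum => x _.
  rewrite /B /w; set m := magnetization R x.
  have g0 := expR_ge0 (N%:R * hamiltonian beta m); have := w'0 x.
  rewrite -/(gibbs_weight beta x) in g0.
  (* Outside the open window the triangle inequality suffices. Inside it, which is the last case,
     [x] belongs to the phase region and the two weights agree. *)
  have [mb|bm] := leP m b; have [am|ma] := leP a m => w'0x;
    rewrite ?andbT ?andbF /=.
  1-3: case: ifP => _; rewrite ?sub0r ?normrN ?(ger0_norm w'0x); try lra;
    by apply: le_trans (ler_normB _ _) _; rewrite !ger0_norm//; lra.
  rewrite inE ifT; last by rewrite ler_norml; apply/andP; split; rewrite -/m; lra.
  rewrite /w' clamped_hamiltonian_id; last by rewrite !ltW.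
  by rewrite subrr normr0 !addr0.
pose q := expR (- (kappa / 2 * N%:R)).
have eE : e = (N%:R + 3) * q ^+ 2 * expR (N%:R * L).
  rewrite /e /E /q -mulrA -expRM_natl -expRD; congr (_ * expR _).
  by field.
have q0 : 0 < q by exact: expR_gt0.
have q1 : q <= 1 by rewrite expR_le1 oppr_le0 mulr_ge0// ltW.
have growth' : 8 * (N%:R + 3) * q <= 1.
  by rewrite /q expRN ler_pdivrMr ?expR_gt0// mul1r.
set X := expR (N%:R * L) in total eE.
have X0 : 0 < X by exact: expR_gt0.
have e8 : 8 * e <= q * X.
  have -> : 8 * e = 8 * (N%:R + 3) * q * (q * X) by rewrite eE; ring.
  by rewrite ler_piMl// mulr_ge0// ltW.
have qX : q * X <= X by rewrite ler_piMl// ltW.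
have Zw : \sum_x w' x - e <= \sum_x w x.
  rewrite lerBlDr -lerBlDl -sumrB; apply: le_trans dist.
  by apply: ler_sum => x _; rewrite distrC ler_norm.
have Z0 : 0 < \sum_x w x by lra.
have eZ : e <= \sum_x w x by lra.
rewrite phase_measureE -/w.
have := cov_perturbation w0 Z0 dist eZ
  (fkg_clamped hbeta (ltW b0) ba N_gt0 finc ginc).
apply: le_trans; rewrite -/q.
rewrite -[leLHS]mulrA -[leRHS]mulrA ler_wpM2r ?mulr_ge0 ?sup_norm_ge0// lerN2 ler_pdivrMr//.
(* From 8 e <= q X <= X the mass of [w] is at least 7/8 X, so 6 e <= 3/4 q X is at most q times this
   mass. *)
have : q * (7 / 8 * X) <= q * \sum_x w x by rewrite ler_pM2l//; lra.
by have := mulr_gt0 q0 X0; lra.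
Qed.
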